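(* Let $M\in\mathbb F_2^{n\times n}$ be a symmetric matrix. Then $\operatorname{diag}(M)\in\operatorname{Im}(M)$. Moreover, the solution set \[ \mathcal S(M)=\{x\in\mathbb F_2^n : Mx=\operatorname{diag}(M)\} \] is a nonempty affine subspace of $\mathbb F_2^n$ of dimension $n-\operatorname{rank}(M)$, and every $x\in\mathcal S(M)$ satisfies \[ \operatorname{diag}(M)^T x\equiv \operatorname{rank}(M)\pmod 2 . \]
   Context: All matrices and vector spaces are over the two-element field $\mathbb F_2$. For a square matrix $M$, $\operatorname{diag}(M)\in\mathbb F_2^n$ denotes its diagonal vector $(M_{11},\dots,M_{nn})^T$ and $\operatorname{Im}(M)$ its column space. A congruence modulo 2 between an element of $\mathbb F_2$ and an integer means that the element equals the image of the integer in $\mathbb F_2$. *)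

(* Defs.v *)
From HB Require Import structures.
From mathcomp Require Export all_boot all_order all_algebra.

Set Implicit Arguments.
Unset Strict Implicit.
Unset Printing Implicit Defensive.

Import GRing.Theory.
Local Open Scope ring_scope.

Definition diagv (n : nat) (M : 'M['F_2]_n) : 'cV['F_2]_n := \col_i M i i.

(* MathComp's [mxalgebra] only has row spaces. *)
Definition colspace (n : nat) (M : 'M['F_2]_n) : {vspace 'cV['F_2]_n} :=
  <<[seq col j M | j : 'I_n]>>%VS.

Definition solset (n : nat) (M : 'M['F_2]_n) : {set 'cV['F_2]_n} :=
  [set x : 'cV['F_2]_n | M *m x == diagv M].

(* [S] is a translate of a linear subspace of dimension [d]; in particular it
   is nonempty. *)
Definition affine_subspace_of_dim (n d : nat) (S : {set 'cV['F_2]_n}) : Prop :=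
  exists (p : 'cV['F_2]_n) (V : {vspace 'cV['F_2]_n}),
    \dim V = d /\ S = [set p + v | v in V].

(* Main.v *)
Require Import Defs.
From mathcomp Require Import all_boot all_order all_algebra.

Import GRing.Theory.
Local Open Scope ring_scope.

(** Over F_2 a symmetric M satisfies y^T M y = diag(M)^T y, so diag(M) is
    orthogonal to ker M, i.e. lies in Im M.  For the parity, write d = diag(M)
    and M x = d.  Then N = M + d d^T = M (1 + x x^T M) has zero diagonal, hence
    even rank.  If d^T x = x^T M x = 0, then 1 + x x^T M is an involution and
    rank N = rank M; otherwise N is a Wedderburn rank reduction of M and
    rank N = rank M - 1. *)

(** The row space of [M] is the direct sum of that of the reduced matrix and the line spanned by
    [u *m M]: the reduced matrix kills [v], whereas [u *m M] takes the value 1 on it. *)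
Lemma wedderburn_rank_reduction (F : fieldType) (m n : nat) (M : 'M[F]_(m, n))
    (u : 'rV_m) (v : 'cV_n) :
  u *m M *m v = 1 -> \rank M = (\rank (M - M *m v *m (u *m M))).+1.
Proof.
move=> uMv1; set M' := M - _.
have M'v0 : M' *m v = 0.
  by rewrite mulmxBl -(mulmxA (M *m v)) uMv1 mulmx1 subrr.
have rank_uM : \rank (u *m M) = 1%N.
  apply/eqP; rewrite eqn_leq rank_leq_row lt0n mxrank_eq0.
  apply: contra_eq_neq uMv1 => ->.
  by rewrite mul0mx eq_sym oner_neq0.
have M'M : (M' <= M)%MS.
  by rewrite addmx_sub // eqmx_opp mulmxA submxMl.
have /eqmxP eqM : (M' + u *m M == M)%MS.
  apply/andP; split; first by rewrite addsmx_sub M'M submxMl.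
  have {1}-> : M = M' + M *m v *m (u *m M) by rewrite subrK.
  by rewrite addmx_sub_adds ?submxMl.
rewrite -eqM mxrank_disjoint_sum ?rank_uM ?addn1 //.
apply/eqP/rowV0P => y; rewrite sub_capmx => /andP[/submxP[a ya] /sub_rVP[b yb]].
have : y *m v = 0 by rewrite ya -mulmxA M'v0 mulmx0.
by rewrite yb -scalemxAl uMv1 => /(congr1 (fun A : 'M_1 => A 0 0)) /[!mxE];
   rewrite eqxx mulr1 => ->; rewrite scale0r.
Qed.

Lemma F2_addrr (V : lmodType 'F_2) (x : V) : x + x = 0.
Proof.
by rewrite -mulr2n -scaler_nat (_ : 2%:R = 0 :> 'F_2) ?scale0r //; apply/val_inj.
Qed.

Lemma F2_oppr (V : lmodType 'F_2) (x : V) : - x = x.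
Proof. by apply/esym/eqP; rewrite -addr_eq0 F2_addrr. Qed.

Lemma F2_neq0 (a : 'F_2) : (a != 0) = (a == 1).
Proof. by case: a => [[|[|]]]. Qed.

Lemma F2_mulrr (a : 'F_2) : a * a = a.
Proof.
have [->|] := eqVneq a 0; first by rewrite mulr0.
by rewrite F2_neq0 => /eqP ->; rewrite mulr1.
Qed.

(** The terms at [(i, j)] and [(j, i)] cancel in characteristic 2. *)
Lemma sum_symmetric_F2 (n : nat) (a : 'I_n -> 'I_n -> 'F_2) :
  (forall i j, a i j = a j i) -> \sum_i \sum_j a i j = \sum_i a i i.
Proof.
move=> asym.
have split_row i : \sum_j a i j =
    a i i + (\sum_(j < n | (i < j)%N) a i j + \sum_(j < n | (j < i)%N) a i j).
  rewrite (bigD1 i) //= (bigID (fun j : 'I_n => (i < j)%N)) /=.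
  by congr (_ + (_ + _)); apply: eq_bigl => j; rewrite -val_eqE /=; case: ltngtP.
rewrite (eq_bigr _ (fun i _ => split_row i)) big_split big_split /=.
rewrite [X in _ + (X + _)](exchange_big_dep predT) //=.
rewrite [X in _ + (X + _)](eq_bigr (fun j : 'I_n => \sum_(i < n | (i < j)%N) a j i)).
  by rewrite (F2_addrr ('F_2)^o) addr0.
by move=> j _; apply: eq_bigr.
Qed.

(** Cross terms cancel by symmetry, and squares of entries equal the entries, so the form is
    linear. *)
Lemma quadratic_form_F2 (n : nat) (M : 'M['F_2]_n) (y : 'cV['F_2]_n) :
  M^T = M -> y^T *m M *m y = (diagv M)^T *m y.
Proof.
move=> Msym; apply/matrixP => i j; rewrite !ord1 !mxE.
under eq_bigr => k _ do rewrite mxE mulr_suml.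
rewrite sum_symmetric_F2; last first.
  move=> k l; rewrite !mxE -{1}Msym mxE.
  by rewrite mulrAC [RHS]mulrAC (mulrC (y k 0)).
by apply: eq_bigr => k _; rewrite !mxE mulrAC F2_mulrr mulrC.
Qed.

Lemma diagvD (n : nat) (A B : 'M['F_2]_n) : diagv (A + B) = diagv A + diagv B.
Proof. by apply/colP => i; rewrite !mxE. Qed.

Lemma diagv_outer (n : nat) (a b : 'cV['F_2]_n) (i : 'I_n) :
  diagv (a *m b^T) i 0 = a i 0 * b i 0.
Proof. by rewrite !mxE big_ord1 mxE. Qed.

Lemma even_rank_alternating (n : nat) (N : 'M['F_2]_n) :
  N^T = N -> diagv N = 0 -> ~~ odd (\rank N).
Proof.
have [r] := ubnP (\rank N); elim: r N => // r IHr N ltNr Nsym Ndiag.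
have [->|N_neq0] := eqVneq N 0; first by rewrite mxrank0.
have /existsP[i /existsP[j /eqP Nij]] : [exists i, exists j, N i j == 1].
  apply: contraNT N_neq0 => noN; apply/eqP/matrixP => i j; rewrite mxE.
  apply/eqP; apply: contraNT noN; rewrite F2_neq0 => Nij.
  by apply/existsP; exists i; apply/existsP; exists j.
set a : 'cV['F_2]_n := delta_mx i 0; set b : 'cV['F_2]_n := delta_mx j 0.
have isotropic (y : 'cV['F_2]_n) : y^T *m N *m y = 0.
  by rewrite quadratic_form_F2 // Ndiag trmx0 mul0mx.
have aT : (N *m a)^T = a^T *m N by rewrite trmx_mul Nsym.
have bT : (N *m b)^T = b^T *m N by rewrite trmx_mul Nsym.
have ab : a^T *m N *m b = 1.
  apply/matrixP => k l; rewrite !ord1 trmx_delta -rowE -colE !mxE eqxx.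
  exact: Nij.
have ba : b^T *m N *m a = 1 by rewrite -bT -[a]trmxK -trmx_mul mulmxA ab trmx1.
(* Two Wedderburn reductions split off the hyperbolic plane spanned by a and b:
   N becomes N - N b a^T N - N a b^T N, which is again alternating. *)
pose N1 := N - N *m b *m (a^T *m N).
(* Since [a] and [b] are isotropic, the first reduction changes neither [N *m a] nor [b^T *m N];
   hence [b] and [a] still pair to 1 under [N1]. *)
have N1a : N1 *m a = N *m a.
  by rewrite mulmxBl -(mulmxA (N *m b)) isotropic mulmx0 subr0.
have bN1 : b^T *m N1 = b^T *m N.
  by rewrite mulmxBr !mulmxA isotropic !mul0mx subr0.
have := wedderburn_rank_reduction _ _ _ N1 b^T a.
rewrite bN1 N1a ba => /(_ erefl) rankN1.
have := wedderburn_rank_reduction _ _ _ N a^T b ab; rewrite -/N1 rankN1 => rankN.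
rewrite rankN /= negbK; apply: IHr.
- by move: ltNr; rewrite rankN ltnS => /ltnW.
- rewrite /N1 !F2_oppr -aT -bT -addrA !linearD /= !trmx_mul !trmxK Nsym.
  by rewrite (addrC (_ *m _)).
(* Both rank-one corrections have the same diagonal, the entrywise product of [N *m a] and [N *m b],
   so their diagonals cancel. *)
- rewrite /N1 !F2_oppr -aT -bT !diagvD Ndiag add0r.
  apply/colP => k; rewrite mxE !diagv_outer mulrC [RHS]mxE.
  exact: (F2_addrr ('F_2)^o).
Qed.

Lemma diagv_in_image (n : nat) (M : 'M['F_2]_n) :
  M^T = M -> exists x : 'cV_n, M *m x = diagv M.
Proof.
move=> Msym.
have /submxP[x dx] : ((diagv M)^T <= M)%MS.
  (* Each column [y] of [cokermx M] satisfies [M *m y = 0], so the quadratic form, and with it the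
     product with the diagonal, vanishes at [y]. *)
  rewrite submxE; apply/eqP/rowP => j.
  have : (diagv M)^T *m col j (cokermx M) = 0.
    rewrite -quadratic_form_F2 // -mulmxA colE (mulmxA M) mulmx_coker.
    by rewrite mul0mx mulmx0.
  by rewrite colE mulmxA -colE => /colP/(_ 0) /[!mxE].
by exists x^T; apply: trmx_inj; rewrite trmx_mul trmxK Msym.
Qed.

Lemma diagv_dot_solution (n : nat) (M : 'M['F_2]_n) (x : 'cV_n) :
  M^T = M -> M *m x = diagv M -> (diagv M)^T *m x = (odd (\rank M))%:R.
Proof.
move=> Msym Mx; set d := diagv M in Mx *.
have dT : d^T = x^T *m M by rewrite -Mx trmx_mul Msym.
set N := M + d *m d^T.
have evenN : ~~ odd (\rank N).
  apply: even_rank_alternating.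
    by rewrite linearD /= trmx_mul trmxK Msym.
  apply/colP => i; rewrite diagvD !mxE big_ord1 !mxE F2_mulrr.
  by rewrite (F2_addrr ('F_2)^o).
have [dx0|] := eqVneq ((d^T *m x) 0 0) 0.
  have dx : d^T *m x = 0 by apply/matrixP => i j; rewrite !ord1 dx0 mxE.
  have rankN : \rank N = \rank M.
    have NE : N = M *m (1%:M + x *m d^T) by rewrite mulmxDr mulmx1 mulmxA Mx.
    have invol : (1%:M + x *m d^T) *m (1%:M + x *m d^T) = 1%:M.
      rewrite mulmxDl mul1mx mulmxDr mulmx1 -(mulmxA x) (mulmxA d^T) dx.
      by rewrite mul0mx mulmx0 addr0 -addrA F2_addrr addr0.
    by rewrite NE mxrankMfree // row_free_unit; case: (mulmx1_unit invol).
  by rewrite dx -rankN (negbTE evenN).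
rewrite F2_neq0 => /eqP dx1.
have dx : d^T *m x = 1 by apply/matrixP => i j; rewrite !ord1 dx1 mxE.
(* As [M *m x = d] and [x^T *m M = d^T], the matrix subtracted here is [d *m d^T]; the sign
   disappears over F_2. *)
have := wedderburn_rank_reduction _ _ _ M x^T x.
rewrite -dT Mx F2_oppr -/N => /(_ dx) ->.
by rewrite /= evenN dx.
Qed.

(** [kermx] acts on rows, so the kernel on columns is obtained by transposing the row kernel of
    [M^T]. The rows of [A] form a basis of it, so [g] is injective and its image has the right
    dimension. *)
Lemma kernel_vspace (F : fieldType) (m n : nat) (M : 'M[F]_(m, n)) :
  exists2 V : {vspace 'cV[F]_n},
    \dim V = (n - \rank M)%N & forall v, (v \in V) = (M *m v == 0).
Proof.
pose A := row_base (kermx M^T).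
pose g : 'Hom('rV[F]_(\rank (kermx M^T)), 'cV[F]_n) :=
  linfun (trmx \o mulmxr A).
have gE u : g u = (u *m A)^T by rewrite lfunE.
exists (limg g).
  rewrite limg_dim_eq ?dimvf ?dim_matrix //.
    by rewrite mul1r mxrank_ker mxrank_tr.
  apply/eqP; rewrite -subv0; apply/subvP => u /memv_capP[_].
  rewrite memv_ker gE memv0 => /eqP/(congr1 trmx); rewrite trmxK trmx0 => uA0.
  by apply/eqP/(row_free_inj (row_base_free _)); rewrite uA0 mul0mx.
move=> v; rewrite -[RHS](inj_eq trmx_inj) trmx_mul trmx0.
rewrite -sub_kermx.
have <- : (v^T <= A)%MS = (v^T <= kermx M^T)%MS by rewrite eq_row_base.
apply/memv_imgP/submxP => [[u _ ->]|[u vE]]; exists u; rewrite ?gE ?trmxK ?memvf //.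
by rewrite -vE trmxK.
Qed.

Theorem theorem1p1 (n : nat) (M : 'M['F_2]_n) (Msym : M^T = M) :
  diagv M \in colspace M
  /\ (solset M != set0
      /\ affine_subspace_of_dim (n - \rank M)%N (solset M))
  /\ (forall x : 'cV['F_2]_n, x \in solset M ->
        ((diagv M)^T *m x) 0 0 = (\rank M)%:R :> 'F_2).
Proof.
have [p Mp] := diagv_in_image _ _ Msym.
split; last split; last first.
- move=> x; rewrite inE => /eqP Mx.
  (* Writing the rank as its parity plus twice its half leaves only the parity in F_2. *)
  rewrite diagv_dot_solution // -[in RHS](odd_double_half (\rank M)).
  rewrite natrD -muln2 natrM (_ : 2%:R = 0 :> 'F_2); last exact/val_inj.
  by rewrite mulr0 addr0; case: odd; rewrite mxE.
- split; first by apply/set0Pn; exists p; rewrite inE Mp.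
  have [V dimV memV] := kernel_vspace _ _ _ M.
  exists p, V; split=> //; apply/setP => x; rewrite inE.
  apply/eqP/imsetP => [Mx|[v vV ->]].
    exists (x - p); last by rewrite addrC subrK.
    by rewrite memV mulmxBr Mx Mp subrr.
  by move: vV; rewrite memV => /eqP Mv; rewrite mulmxDr Mv addr0.
(* The entries of a solution [p] are the coefficients of the diagonal on the columns of [M]. *)
have -> : diagv M = \sum_j p j 0 *: col j M.
  by rewrite -Mp; apply/colP => i; rewrite summxE !mxE;
     apply: eq_bigr => j _; rewrite !mxE mulrC.
rewrite memv_suml // => j _; rewrite memvZ // memv_span //.
exact: image_f.
Qed.
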